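(* If $G$ and $H$ are both graphs of stably matchable pairs, then so is their Cartesian product $G\mathbin{\square} H$.
   Context: The Cartesian product $G\mathbin{\square}H$ has vertex set $V(G)\times V(H)$, with $(g,h)$ adjacent to $(g',h')$ when either $g=g'$ and $hh'\in E(H)$, or $h=h'$ and $gg'\in E(G)$. A stable matching instance consists of finite disjoint sets of students and residencies, where each student has a strict linear preference order on a subset of the residencies and each residency has a strict linear preference order on a subset of the students. A matching (set of student–residency pairs, each element in at most one pair) is stable if each of its pairs is mutually acceptable (each member appears in the other's list) and no mutually acceptable pair $(s,r)$ not in it has both $s$ unmatched or preferring $r$ to its partner and $r$ unmatched or preferring $s$ to its partner. The graph of stably matchable pairs of the instance is the bipartite graph whose vertices are all students and residencies and whose edges are the pairs occurring in at least one stable matching. A graph is a graph of stably matchable pairs if it is isomorphic to the graph of stably matchable pairs of some stable matching instance. *)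

(* Defs.v *)
From HB Require Import structures.
From mathcomp Require Import all_boot.

Set Implicit Arguments.
Unset Strict Implicit.
Unset Printing Implicit Defensive.

Record sgraph := SGraph {
  vertex :> finType;
  adj : rel vertex;
  adj_sym : symmetric adj;
  adj_irrefl : irreflexive adj
}.

Definition isomorphic (G H : sgraph) : Prop :=
  exists2 f : G -> H, bijective f & forall x y, adj (f x) (f y) = adj x y.

Section CartesianProduct.
Variables G H : sgraph.

Definition cart_adj : rel (G * H) := fun x y =>
  ((x.1 == y.1) && adj x.2 y.2) || ((x.2 == y.2) && adj x.1 y.1).

Fact cart_adj_sym : symmetric cart_adj.
Proof.
by move=> x y; rewrite /cart_adj ![y.1 == _]eq_sym ![y.2 == _]eq_sym
  ![adj y.1 _]adj_sym ![adj y.2 _]adj_sym.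
Qed.

Fact cart_adj_irrefl : irreflexive cart_adj.
Proof. by move=> x; rewrite /cart_adj !adj_irrefl !andbF. Qed.

Definition cartesian_product : sgraph := SGraph cart_adj_sym cart_adj_irrefl.

End CartesianProduct.

(* A strict linear order on a subset of a finite type is given by the
   duplicate-free list of the elements of that subset, most preferred first. *)
Record instance := Instance {
  student : finType;
  residency : finType;
  spref : student -> seq residency;
  rpref : residency -> seq student;
  spref_uniq : forall s, uniq (spref s);
  rpref_uniq : forall r, uniq (rpref r)
}.

(* Meaningful as a preference only between members of the list. *)
Definition prefers (T : eqType) (l : seq T) (x y : T) : bool :=
  index x l < index y l.

Section StableMatching.
Variable I : instance.
Implicit Types (M : {set student I * residency I}).
Implicit Types (s : student I) (r : residency I).

Definition acceptable s r : bool := (r \in spref s) && (s \in rpref r).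

Definition is_matching M : bool :=
  [forall p in M, forall q in M, (p.1 == q.1) || (p.2 == q.2) ==> (p == q)].

Definition student_wants M s r : bool :=
  [forall r', (s, r') \notin M]
  || [exists r', ((s, r') \in M) && prefers (spref s) r r'].

Definition residency_wants M s r : bool :=
  [forall s', (s', r) \notin M]
  || [exists s', ((s', r) \in M) && prefers (rpref r) s s'].

Definition blocking M s r : bool :=
  [&& acceptable s r, (s, r) \notin M, student_wants M s r
    & residency_wants M s r].

Definition stable M : bool :=
  [&& is_matching M,
      [forall p in M, acceptable p.1 p.2]
    & [forall s, forall r, ~~ blocking M s r]].

Definition stably_matchable s r : bool :=
  [exists M : {set student I * residency I}, stable M && ((s, r) \in M)].

(* The sum type makes students and residencies disjoint. *)
Definition smp_adj : rel (student I + residency I) := fun x y =>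
  match x, y with
  | inl s, inr r | inr r, inl s => stably_matchable s r
  | _, _ => false
  end.

Fact smp_adj_sym : symmetric smp_adj.
Proof. by case=> x [] y. Qed.

Fact smp_adj_irrefl : irreflexive smp_adj.
Proof. by case. Qed.

Definition stable_pairs_graph : sgraph := SGraph smp_adj_sym smp_adj_irrefl.

End StableMatching.

Definition is_stable_pairs_graph (G : sgraph) : Prop :=
  exists I : instance, isomorphic G (stable_pairs_graph I).

(* Main.v *)
Require Import Defs.
From mathcomp Require Import all_boot.

(** Shrinking the list of each vertex to its neighbours in the graph of stably
    matchable pairs keeps every stable matching stable. In the product, 2-colour
    the vertices, let one colour class prefer every G-neighbour to every
    H-neighbour, and let the other class do the opposite. If M and N are stable
    for G and H, then using M in every copy of G, and N in the copies of H
    indexed by the vertices that M leaves unmatched, is stable: an H-edge at a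
    vertex matched by M is refused by its end that prefers G-neighbours. Every
    G-edge of the product is covered this way, and every H-edge by exchanging
    the roles of G and H. *)

Set Implicit Arguments.
Unset Strict Implicit.
Unset Printing Implicit Defensive.

(** A discarded element differs from both [x] and [y], so dropping it shifts both indices by one and
    keeps their order. *)
Lemma index_filter_leq (T : eqType) (a : pred T) (s : seq T) (x y : T) :
  a x -> a y ->
  (index x (filter a s) <= index y (filter a s)) = (index x s <= index y s).
Proof.
move=> ax ay; elim: s => //= t s IHs.
case: ifPn => [at_|nat_] /=.
  by case: (t == x) => //; case: (t == y).
have /negPf-> : t != x by apply: contraNneq nat_ => ->.
have /negPf-> : t != y by apply: contraNneq nat_ => ->.
by rewrite ltnS.
Qed.

Definition swap (S T : Type) (u : S * T) : T * S := (u.2, u.1).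

(** * Stable matchings as relations on a graph *)

Section StableRelation.
Variable G : sgraph.
Implicit Types (pref : G -> seq G) (M : rel G) (x y : G).

(* The case [z = y] is included, so that pairs of the matching need no separate
   treatment in the stability condition. *)
Definition held pref M x y : Prop :=
  exists2 z, M x z & index z (pref x) <= index y (pref x).

(** No end of an edge is singled out as the student: an edge fails to block because one of its ends
    holds a partner at least as good as the other end. *)
Definition stable_rel pref M : Prop :=
  [/\ symmetric M, forall x y z, M x y -> M x z -> y = z, subrel M (@adj G)
    & forall x y, adj x y -> held pref M x y \/ held pref M y x].

Definition adj_pref pref : Prop :=
  forall x, uniq (pref x) /\ pref x =i @adj G x.

(* The existence of some [M] is a separate clause because of edgeless graphs. *)
Definition all_pairs_stable pref : Prop :=
  (exists M, stable_rel pref M) /\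
  forall x y, adj x y -> exists2 M, stable_rel pref M & M x y.

Definition bicoloring (c : G -> bool) : Prop :=
  forall x y, adj x y -> c y = ~~ c x.

End StableRelation.

Definition preference_realizable (G : sgraph) : Prop :=
  exists (c : G -> bool) (pref : G -> seq G),
    [/\ bicoloring c, adj_pref pref & all_pairs_stable pref].

(** * Transport along graph isomorphisms *)

Section Transport.
Variables (G H : sgraph) (f : G -> H) (g : H -> G).
Hypotheses (fK : cancel f g) (gK : cancel g f).
Hypothesis f_adj : forall x y, adj (f x) (f y) = adj x y.

(** The lists of [G] need only agree with the transported ones, so this also serves for the exchange
    of the two factors of a product. *)
Lemma stable_rel_transport (prefG : G -> seq G) (prefH : H -> seq H) M :
  (forall x, prefG x = map g (prefH (f x))) ->
  stable_rel prefH M -> stable_rel prefG (relpre f M).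
Proof.
move=> eq_pref [Msym Mfun Madj Mst]; split=> [x y|x y z|x y|x y] /=.
- exact: Msym.
- by move=> Mxy Mxz; apply: (can_inj fK); apply: Mfun Mxy Mxz.
- by move/Madj; rewrite f_adj.
have heldP u v : held prefH M (f u) (f v) -> held prefG (relpre f M) u v.
  case=> z Muz le_z; exists (g z); rewrite /= ?gK // eq_pref.
  by rewrite -[v]fK !index_map //; apply: can_inj gK.
by rewrite -f_adj => /Mst[] /heldP; [left | right].
Qed.

Lemma preference_realizable_iso :
  preference_realizable H -> preference_realizable G.
Proof.
case=> c [pref [c_adj pref_adj [[M0 M0st] Mst]]].
exists (c \o f), (fun x => map g (pref (f x))); split.
- by move=> x y; rewrite -f_adj => /c_adj.
- move=> x; have [uniq_x mem_x] := pref_adj (f x); split.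
    by rewrite map_inj_uniq //; apply: can_inj gK.
  move=> y; rewrite -{1}[y]fK mem_map; last exact: can_inj gK.
  by rewrite mem_x; apply: f_adj.
split; first by exists (relpre f M0); apply: stable_rel_transport M0st.
move=> x y; rewrite -f_adj => /Mst[M st_M Mxy].
by exists (relpre f M) => //; apply: stable_rel_transport st_M.
Qed.

End Transport.

(** * From an instance to preferences on its graph *)

Section InstanceToGraph.
Variable I : instance.
Notation G := (stable_pairs_graph I).

Definition reduced_pref (x : G) : seq G :=
  match x with
  | inl s => map inr (filter (stably_matchable s) (spref s))
  | inr r => map inl (filter (fun s => stably_matchable s r) (rpref r))
  end.

Definition rel_of_matching (M : {set student I * residency I}) : rel G :=
  fun x y => match x, y with
  | inl s, inr r | inr r, inl s => (s, r) \in M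
  | _, _ => false
  end.

Lemma stably_matchable_acceptable (s : student I) (r : residency I) :
  stably_matchable s r -> acceptable s r.
Proof.
by case/existsP=> M /andP[/and3P[_ /forall_inP accM _] /accM].
Qed.

Lemma reduced_pref_adj : adj_pref reduced_pref.
Proof.
have inlI : injective (@inl (student I) (residency I)) by move=> ? ? [].
have inrI : injective (@inr (student I) (residency I)) by move=> ? ? [].
case=> [s|r]; split=> /=.
- by rewrite map_inj_uniq // filter_uniq // spref_uniq.
- case=> [s'|r]; first by apply/mapP=> -[].
  rewrite mem_map // mem_filter; apply/andb_idr.
  by move/stably_matchable_acceptable/andP=> [].
- by rewrite map_inj_uniq // filter_uniq // rpref_uniq.
case=> [s|r']; last by apply/mapP=> -[].
rewrite mem_map // mem_filter; apply/andb_idr.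
by move/stably_matchable_acceptable/andP=> [].
Qed.

(** Partners in [M] are stably matchable, so they survive the filtering, which keeps the order among
    the surviving entries. *)
Lemma stable_rel_of_matching (M : {set student I * residency I}) :
  stable M -> stable_rel reduced_pref (rel_of_matching M).
Proof.
have inlI : injective (@inl (student I) (residency I)) by move=> ? ? [].
have inrI : injective (@inr (student I) (residency I)) by move=> ? ? [].
move=> st_M; have matchM s r : (s, r) \in M -> stably_matchable s r.
  by move=> Msr; apply/existsP; exists M; rewrite st_M.
case/and3P: st_M => /forall_inP matM _ /forallP st_M.
have eqM p q : p \in M -> q \in M -> (p.1 == q.1) || (p.2 == q.2) -> p = q.
  by move=> /matM/forall_inP matp /matp/implyP eq_pq /eq_pq/eqP.
have heldM s r : stably_matchable s r ->
    held reduced_pref (rel_of_matching M) (inl s) (inr r) \/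
    held reduced_pref (rel_of_matching M) (inr r) (inl s).
  move=> m_sr; have [Msr|nMsr] := boolP ((s, r) \in M).
    by left; exists (inr r).
  (* The pair does not block, so one of its members is matched and does not prefer the other to its
     partner. *)
  have /forallP/(_ r) := st_M s.
  rewrite /blocking (stably_matchable_acceptable m_sr) nMsr /= negb_and.
  case/orP; rewrite negb_or negb_forall negb_exists.
    case/andP=> /existsP[r' /negPn Msr'] /forallP/(_ r'); rewrite Msr' -leqNgt.
    move=> le_r'; left; exists (inr r') => //=.
    by rewrite !index_map // index_filter_leq // matchM.
  case/andP=> /existsP[s' /negPn Msr'] /forallP/(_ s'); rewrite Msr' -leqNgt.
  move=> le_s'; right; exists (inl s') => //=.
  by rewrite !index_map // index_filter_leq // matchM.
split.
- by case=> ? [].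
- case=> [s|r] [s1|r1] [s2|r2] //= M1 M2.
    by have [->] := eqM _ _ M1 M2 (introT orP (or_introl (eqxx _))).
  by have [->] := eqM _ _ M1 M2 (introT orP (or_intror (eqxx _))).
- by case=> ? [] //= ?; apply: matchM.
case=> [s|r] [s'|r'] //= /heldM //.
by case; [right | left].
Qed.

Lemma preference_realizable_instance : preference_realizable G.
Proof.
exists (fun x : G => if x is inl _ then true else false), reduced_pref.
split; first by case=> ? [].
  exact: reduced_pref_adj.
have ex_st (x y : G) : adj x y ->
    exists2 M, stable_rel reduced_pref M & M x y.
  by case: x y => [s|r] [s'|r'] //= /existsP[M /andP[st_M Msr]];
    exists (rel_of_matching M) => //; apply: stable_rel_of_matching.
split=> //; have [/existsP[x /existsP[y xy]]|no_adj] :=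
    boolP [exists x : G, exists y : G, adj x y].
  by have [M st_M _] := ex_st x y xy; exists M.
(* Without edges nothing can block the empty matching. *)
exists (fun _ _ => false); split=> // x y xy.
by case/existsP: no_adj; exists x; apply/existsP; exists y.
Qed.

End InstanceToGraph.

(** * From preferences on a 2-coloured graph to an instance *)

Section GraphToInstance.
Variables (G : sgraph) (c : G -> bool) (pref : G -> seq G).
Hypotheses (c_adj : bicoloring c) (pref_adj : adj_pref pref).
Hypothesis pref_st : all_pairs_stable pref.

Let S := {x : G | c x}.
Let R := {x : G | ~~ c x}.

Definition color_spref (s : S) : seq R := pmap insub (pref (val s)).
Definition color_rpref (r : R) : seq S := pmap insub (pref (val r)).

Fact color_spref_uniq s : uniq (color_spref s).
Proof. by rewrite pmap_sub_uniq //; have [] := pref_adj (val s). Qed.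

Fact color_rpref_uniq r : uniq (color_rpref r).
Proof. by rewrite pmap_sub_uniq //; have [] := pref_adj (val r). Qed.

Definition color_instance := Instance color_spref_uniq color_rpref_uniq.

(** Matching on [idP] supplies in each branch the proof of colour that the subtype requires. *)
Definition color_sum (x : G) : S + R :=
  match @idP (c x) with
  | ReflectT cx => inl (exist _ x cx)
  | ReflectF ncx => inr (exist _ x (introT negP ncx))
  end.

Definition color_val (u : S + R) : G :=
  match u with inl s => val s | inr r => val r end.

Lemma color_sumK : cancel color_sum color_val.
Proof. by move=> x; rewrite /color_sum; case: {-}_ / idP. Qed.

Lemma color_valK : cancel color_val color_sum.
Proof.
rewrite /color_sum; case=> [] [x cx] /=.
  by case: {-}_ / idP => [?|//]; congr inl; apply: val_inj.
by case: {-}_ / idP => [cx'|?]; [case/negP: cx | congr inr; apply: val_inj].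
Qed.

(** All neighbours of [s] have the other colour, so [pmap insub] drops nothing and positions are
    unchanged. *)
Lemma index_color_spref s (r : R) :
  index r (color_spref s) = index (val r) (pref (val s)).
Proof.
rewrite -(index_map val_inj) /color_spref pmap_filter; last exact: insubK.
congr index; apply/all_filterP/allP => y.
rewrite (pref_adj _).2 => /c_adj cy.
by rewrite isSome_insub cy (valP s).
Qed.

Lemma index_color_rpref r (s : S) :
  index s (color_rpref r) = index (val s) (pref (val r)).
Proof.
rewrite -(index_map val_inj) /color_rpref pmap_filter; last exact: insubK.
congr index; apply/all_filterP/allP => y.
rewrite (pref_adj _).2 => /c_adj cy.
by rewrite isSome_insub cy (valP r).
Qed.

Lemma color_acceptable (s : S) (r : R) :
  @acceptable color_instance s r = adj (val s) (val r).
Proof.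
rewrite /acceptable /= !mem_pmap_sub !(pref_adj _).2.
by rewrite -!topredE /= [adj (val r) _]adj_sym andbb.
Qed.

Lemma color_stable M : stable_rel pref M ->
  @stable color_instance [set p | M (val p.1) (val p.2)].
Proof.
case=> Msym Mfun Madj Mst; apply/and3P; split.
- apply/forall_inP=> -[s r]; rewrite inE /= => Msr.
  apply/forall_inP=> -[s' r']; rewrite inE /= => Msr'.
  apply/implyP=> /orP[] /eqP eq1; subst.
    by apply/eqP; congr pair; apply: val_inj; apply: Mfun Msr Msr'.
  apply/eqP; congr pair; apply: val_inj.
  by move: Msr Msr'; rewrite !(Msym _ (val r')); apply: Mfun.
- by apply/forall_inP=> -[s r]; rewrite inE color_acceptable => /Madj.
apply/forallP=> s; apply/forallP=> r; apply/negP; case/and4P.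
rewrite color_acceptable inE /= => /Mst[] [z Mz le_z] nMsr.
  (* As a neighbour of [s], the vertex [z] is a residency. It is the partner of [s], so [s] is
     neither unmatched nor prefers [r]. *)
  have ncz : ~~ c z by rewrite (c_adj (Madj _ _ Mz)) (valP s).
  case/orP=> [/forallP/(_ (Sub z ncz))|/existsP[r' /andP[]]].
    by rewrite inE /= Mz.
  rewrite inE /= /prefers !index_color_spref => Msr'.
  by rewrite (Mfun _ _ _ Msr' Mz : val r' = z) ltnNge le_z.
have cz : c z by rewrite (c_adj (Madj _ _ Mz)) (valP r).
move=> _; case/orP=> [/forallP/(_ (Sub z cz))|/existsP[s' /andP[]]].
  by rewrite inE /= Msym Mz.
rewrite inE /= /prefers !index_color_rpref Msym => Msr'.
by rewrite (Mfun _ _ _ Msr' Mz : val s' = z) ltnNge le_z.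
Qed.

(** Acceptability confines the stable pairs to edges, and [pref_st] puts every edge in a stable
    matching. *)
Lemma color_matchable (s : S) (r : R) :
  @stably_matchable color_instance s r = adj (val s) (val r).
Proof.
apply/idP/idP => [/stably_matchable_acceptable|]; first by rewrite color_acceptable.
case/pref_st.2=> M st_M Msr; apply/existsP.
by exists [set p | M (val p.1) (val p.2)]; rewrite color_stable // inE.
Qed.

Lemma color_instance_graph : is_stable_pairs_graph G.
Proof.
exists color_instance, color_sum.
  by exists color_val; [apply: color_sumK | apply: color_valK].
move=> x y; rewrite -{2}[x]color_sumK -{2}[y]color_sumK.
have same_color u v : c u = c v -> adj u v = false.
  by move=> eq_c; apply/negP=> /c_adj; rewrite eq_c; case: (c v).
case: (color_sum x) (color_sum y) => [s|r] [s'|r'] /=.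
- by rewrite same_color // (valP s) (valP s').
- exact: color_matchable.
- by rewrite adj_sym; apply: color_matchable.
by rewrite same_color // (negPf (valP r)) (negPf (valP r')).
Qed.

End GraphToInstance.

Lemma is_stable_pairs_graphP (G : sgraph) :
  is_stable_pairs_graph G <-> preference_realizable G.
Proof.
split=> [[I [f [g fK gK] f_adj]]|[c [pref [c_adj pref_adj pref_st]]]].
  exact: preference_realizable_iso fK gK f_adj (preference_realizable_instance I).
exact: color_instance_graph c_adj pref_adj pref_st.
Qed.

(** * Preferences and matchings on the product *)

Section ProductPreference.
Variables (G H : sgraph) (prefG : G -> seq G) (prefH : H -> seq H).
Variable c : G * H -> bool.
Notation GH := (cartesian_product G H).

Definition prod_pref (u : GH) : seq GH :=
  let sG := [seq (x, u.2) | x <- prefG u.1] in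
  let sH := [seq (u.1, y) | y <- prefH u.2] in
  if c u then sG ++ sH else sH ++ sG.

Definition prod_rel (M : rel G) (N : rel H) : rel GH := fun u v =>
  (u.2 == v.2) && M u.1 v.1 ||
  [&& u.1 == v.1, N u.2 v.2 & [forall x, ~~ M u.1 x]].

Hypotheses (prefG_adj : adj_pref prefG) (prefH_adj : adj_pref prefH).

Lemma mem_map_prefG (x x' : G) (y y' : H) :
  (x', y') \in [seq (z, y) | z <- prefG x] = (y == y') && adj x x'.
Proof.
apply/mapP/andP => [[z zx [-> ->]]|[/eqP<- xx']].
  by split=> //; move: zx; rewrite (prefG_adj x).2.
by exists x'; rewrite // (prefG_adj x).2.
Qed.

Lemma mem_map_prefH (x x' : G) (y y' : H) :
  (x', y') \in [seq (x, z) | z <- prefH y] = (x == x') && adj y y'.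
Proof.
apply/mapP/andP => [[z zy [-> ->]]|[/eqP<- yy']].
  by split=> //; move: zy; rewrite (prefH_adj y).2.
by exists y'; rewrite // (prefH_adj y).2.
Qed.

Lemma prod_pref_adj : adj_pref prod_pref.
Proof.
case=> x y; split; last first.
  case=> x' y'; rewrite -[RHS]/(cart_adj (x, y) (x', y')) /cart_adj /prod_pref /=.
  by case: (c _); rewrite mem_cat mem_map_prefG mem_map_prefH // orbC.
rewrite /prod_pref /=.
have uniqGH : uniq ([seq (x', y) | x' <- prefG x] ++ [seq (x, y') | y' <- prefH y]).
  rewrite cat_uniq !map_inj_uniq; try by move=> ? ? [].
  rewrite (prefG_adj x).1 (prefH_adj y).1 andbT /=.
  apply/hasPn => -[x' y']; rewrite mem_map_prefH mem_map_prefG => /andP[/eqP<-].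
  by rewrite adj_irrefl andbF.
by case: (c _); rewrite // uniq_catC.
Qed.

(** The block of [H]-neighbours comes after both entries or shifts both by its length. *)
Lemma index_prod_prefG (x : G) (y : H) x1 x2 : adj x x1 -> adj x x2 ->
  index x1 (prefG x) <= index x2 (prefG x) ->
  index (x1, y) (prod_pref (x, y)) <= index (x2, y) (prod_pref (x, y)).
Proof.
move=> xx1 xx2 le12; rewrite /prod_pref /=.
have pairG : injective (fun z : G => (z, y)) by move=> ? ? [].
by case: (c _); rewrite !index_cat ?mem_map_prefG ?mem_map_prefH ?xx1 ?xx2 ?eqxx ?adj_irrefl ?andbF /=
  !index_map ?leq_add2l.
Qed.

Lemma index_prod_prefH (x : G) (y : H) y1 y2 : adj y y1 -> adj y y2 ->
  index y1 (prefH y) <= index y2 (prefH y) ->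
  index (x, y1) (prod_pref (x, y)) <= index (x, y2) (prod_pref (x, y)).
Proof.
move=> yy1 yy2 le12; rewrite /prod_pref /=.
have pairH : injective (fun z : H => (x, z)) by move=> ? ? [].
by case: (c _); rewrite !index_cat ?mem_map_prefG ?mem_map_prefH ?yy1 ?yy2 ?eqxx ?adj_irrefl ?andbF /=
  !index_map ?leq_add2l.
Qed.

(** By colour, [(x', y)] lies in the first block, while [(x, y')] is indexed past the length of that
    block. *)
Lemma index_prod_prefGH (x : G) (y : H) x' y' : c (x, y) -> adj x x' -> adj y y' ->
  index (x', y) (prod_pref (x, y)) <= index (x, y') (prod_pref (x, y)).
Proof.
move=> cxy xx' yy'; rewrite /prod_pref /= cxy !index_cat !mem_map_prefG.
rewrite xx' eqxx adj_irrefl andbF /=; apply: leq_trans (leq_addr _ _).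
by apply: ltnW; rewrite index_mem mem_map_prefG eqxx.
Qed.

Lemma prod_rel_stable M N : bicoloring (G := GH) c ->
  stable_rel prefG M -> stable_rel prefH N ->
  stable_rel prod_pref (prod_rel M N).
Proof.
move=> c_adj [Msym Mfun Madj Mst] [Nsym Nfun Nadj Nst]; split.
- move=> [x y] [x' y']; rewrite /prod_rel /= Msym Nsym eq_sym.
  (* The freeness test looks at [u.1] only, which equals [v.1] in this disjunct. *)
  by congr (_ || _); rewrite eq_sym; case: eqP => // ->.
- move=> [x y] [x1 y1] [x2 y2]; rewrite /prod_rel /=.
  case/orP=> [/andP[/eqP<- M1]|/and3P[/eqP<- N1 /forallP fr1]];
    case/orP=> [/andP[/eqP<- M2]|/and3P[/eqP<- N2 /forallP fr2]].
  + by rewrite (Mfun _ _ _ M1 M2).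
  + by have := fr2 x1; rewrite M1.
  + by have := fr1 x2; rewrite M2.
  by rewrite (Nfun _ _ _ N1 N2).
- move=> [x y] [x' y'] /orP[/andP[/= y_y' /Madj xx']|/and3P[/= x_x' /Nadj yy' _]].
    by rewrite /cart_adj /= y_y' xx' orbT.
  by rewrite /cart_adj /= x_x' yy'.
move=> [x y] [x' y'] uv; have cv := c_adj _ _ uv.
case/orP: uv cv => /andP[/= /eqP eq_xy]; subst; [move=> yy' cv | move=> xx' _].
  (* An [H]-edge over [x']: if [M] leaves [x'] free, this copy of [H] carries [N], whose stability
     decides. *)
  have [/forallP free|] := boolP [forall z, ~~ M x' z].
    have heldN y1 y2 : adj y1 y2 -> held prefH N y1 y2 ->
        held prod_pref (prod_rel M N) (x', y1) (x', y2).
      move=> y12 [z Nz le_z]; exists (x', z).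
        by rewrite /prod_rel /= eqxx Nz; apply/orP; right; apply/forallP.
      by apply: index_prod_prefH => //; apply: Nadj.
    have y'y : adj y' y by rewrite adj_sym.
    by case: (Nst _ _ yy') => [/(heldN _ _ yy')|/(heldN _ _ y'y)]; [left | right].
  rewrite negb_forall => /existsP[z /negPn Mz].
  (* Here [M] matches [x'] in every copy of [G]. The colours of the two ends differ, so one end
     ranks its [G]-partner above the whole [H]-block. *)
  have heldG y1 y2 : adj y1 y2 -> c (x', y1) ->
      held prod_pref (prod_rel M N) (x', y1) (x', y2).
    move=> y12 cy1; exists (z, y1); first by rewrite /prod_rel /= eqxx Mz.
    by apply: index_prod_prefGH => //; apply: Madj.
  have [cy|ncy] := boolP (c (x', y)); first by left; apply: heldG.
  by right; apply: heldG; rewrite 1?adj_sym // cv ncy.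
(* Every copy of [G] carries all of [M], so for a [G]-edge the stability of [M] suffices. *)
have heldM x1 x2 : adj x1 x2 -> held prefG M x1 x2 ->
    held prod_pref (prod_rel M N) (x1, y') (x2, y').
  move=> x12 [z Mz le_z]; exists (z, y'); first by rewrite /prod_rel /= eqxx Mz.
  by apply: index_prod_prefG => //; apply: Madj.
have x'x : adj x' x by rewrite adj_sym.
by case: (Mst _ _ xx') => [/(heldM _ _ xx')|/(heldM _ _ x'x)]; [left | right].
Qed.

End ProductPreference.

(** * Exchanging the factors, and the conclusion *)

Lemma swap_adj (G H : sgraph) (u v : cartesian_product G H) :
  adj (swap u : cartesian_product H G) (swap v) = adj u v.
Proof. exact: orbC. Qed.

(** Exchanging the factors also exchanges which block [prod_pref] puts first, and complementing the
    colour undoes this. *)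
Lemma prod_pref_swap (G H : sgraph) (prefG : G -> seq G) (prefH : H -> seq H)
    (c : G * H -> bool) (u : G * H) :
  prod_pref prefG prefH c u =
  map (@swap H G) (prod_pref prefH prefG (fun v => ~~ c (swap v)) (swap u)).
Proof.
case: u => x y; rewrite /prod_pref /=.
by case: (c _); rewrite /= map_cat -!map_comp.
Qed.

Theorem theorem11 (G H : sgraph) (hG : is_stable_pairs_graph G)
  (hH : is_stable_pairs_graph H) :
  is_stable_pairs_graph (cartesian_product G H).
Proof.
move: hG hH => /is_stable_pairs_graphP[cG [pG [cG_adj pG_adj [[M0 st_M0] stG]]]].
move=> /is_stable_pairs_graphP[cH [pH [cH_adj pH_adj [[N0 st_N0] stH]]]].
apply/is_stable_pairs_graphP.
(* An edge of the product changes one coordinate along an edge of its factor, which flips exactly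
   one summand. *)
pose c (u : G * H) := cG u.1 (+) cH u.2.
have c_adj : @bicoloring (cartesian_product G H) c.
  move=> [x y] [x' y'] /orP[] /andP[/= /eqP<-].
    by rewrite /c /= => /cH_adj->; rewrite addbN.
  by rewrite /c /= => /cG_adj->; rewrite addNb.
pose c' (v : H * G) := ~~ c (swap v).
have c'_adj : @bicoloring (cartesian_product H G) c'.
  by move=> u v; rewrite -swap_adj /c' => /c_adj->.
exists c, (prod_pref pG pH c); split=> //; first exact: prod_pref_adj.
split; first by exists (prod_rel M0 N0); apply: prod_rel_stable.
move=> [x y] [x' y'] /orP[] /andP[/= /eqP<-].
  case/stH=> N st_N Nyy'.
  (* For an [H]-edge, [N] is used in every copy of [H], and any stable [M0] in the copies of [G] at
     vertices that [N] leaves free. *)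
  exists (relpre (@swap G H) (prod_rel N M0)); last by rewrite /prod_rel /= eqxx Nyy'.
  apply: (@stable_rel_transport (cartesian_product G H) (cartesian_product H G)
    (@swap G H) (@swap H G) _ _ (@swap_adj G H) _ (prod_pref pH pG c')); try by case.
    exact: prod_pref_swap.
  exact: prod_rel_stable.
case/stG=> M st_M Mxx'.
by exists (prod_rel M N0); [apply: prod_rel_stable | rewrite /prod_rel /= eqxx Mxx'].
Qed.
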